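(* Let $\mathcal{P}$ be a finite poset with order relation $<_p$. Suppose the elements of $\mathcal{P}$ are colored with the colors $1,2,\dots,k$ (each element has exactly one color and all colors are used), and the coloring is order-preserving: if $a<_p b$ then the color of $a$ is smaller than the color of $b$. Then there exists a constant $C$ (depending on $\mathcal{P}$ and its coloring) such that for every $n$ and every family $\mathcal{F}$ of subsets of $[n]$ with $|\mathcal{F}|>C\binom{n}{\lfloor\frac{n}{2}\rfloor}$, there is an embedding $f:\mathcal{P}\to\mathcal{F}$ that maps all elements of the same color to sets of the same size.
   Context: $[n]=\{1,2,\dots,n\}$. A map $f$ from a poset $\mathcal{P}$ to subsets of $[n]$ is an embedding if it is injective and $f(a)\subset f(b)$ whenever $a<_p b$. *)

(* Defs.v *)
From mathcomp Require Import all_boot all_order.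

Set Implicit Arguments.
Unset Strict Implicit.
Unset Printing Implicit Defensive.

(* The ground set [n] is 'I_n and the colors 1, ..., k are the elements of 'I_k. *)

Definition order_preserving_coloring (d : Order.disp_t) (P : finPOrderType d)
    (k : nat) (c : P -> 'I_k) : Prop :=
  (forall i : 'I_k, exists a : P, c a = i) /\
  (forall a b : P, (a < b)%O -> (c a < c b)%N).

(* Together with injectivity, \subset here amounts to \proper.  The image need
   not be an induced copy of P: incomparable elements may be sent to comparable
   sets. *)
Definition embedding (d : Order.disp_t) (P : finPOrderType d) (n : nat)
    (f : P -> {set 'I_n}) : Prop :=
  injective f /\ (forall a b : P, (a < b)%O -> f a \subset f b).

(* Main.v *)
(** Let m = |P|.  Call an interval X < Z of a family heavy if m members of equal
    size lie strictly between X and Z.  It suffices to stack k heavy intervals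
    on top of each other, as the j-th color class can then be sent injectively to
    the m sets in the j-th interval.

    Let a family G have no heavy interval and let N be its number of members on a
    uniformly random maximal chain.  Given that X < Z lie on the chain, the
    expected number of members strictly between them is at most m; summing over
    X and Z gives E[N^3] <= 6 (m + 2) E[N^2], so E[N] is bounded, and hence so is
    |G| / C(n, n/2).  The members of F that are not the bottom of a heavy interval
    form such a family; removing them k times leaves a nonempty family as soon as
    |F| is large, and the removals give the stack. *)

Require Import Defs.
From mathcomp Require Import all_boot all_order.
From mathcomp Require Import perm fingroup.
From mathcomp Require Import zify.

Set Implicit Arguments.
Unset Strict Implicit.
Unset Printing Implicit Defensive.

(** * Binomial estimates and counting by fibers *)

Lemma leq_bin_half (n k : nat) : 'C(n, k) <= 'C(n, n./2).
Proof.
have mono i : i.*2.+1 <= n -> 'C(n, i) <= 'C(n, i.+1).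
  move=> lti; have := mul_bin_left n i.
  rewrite -(leq_pmul2l (ltn0Sn i)) => ->.
  by rewrite leq_mul2r; apply/orP; right; lia.
have low d : forall i, i + d = n./2 -> 'C(n, i) <= 'C(n, n./2).
  elim: d => [|d IHd] i; first by rewrite addn0 => ->.
  rewrite addnS -addSn => Ei; apply: leq_trans (IHd _ Ei).
  by apply: mono; lia.
have [le_k | gt_k] := leqP k n./2; first by apply: (low (n./2 - k)); lia.
have [le_kn | lt_nk] := leqP k n; last by rewrite bin_small.
by rewrite -bin_sub //; apply: (low (n./2 - (n - k))); lia.
Qed.

Lemma leq_bin_interior (a i : nat) : 0 < i < a -> a <= 'C(a, i).
Proof.
elim: a i => [|a IHa] [|i] //=; rewrite ltnS => lt_ia.
rewrite binS; have [lt_i|ge_i] := ltnP i.+1 a.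
  have := IHa i.+1; rewrite lt_i => /(_ isT).
  have : 0 < 'C(a, i) by rewrite bin_gt0; lia.
  lia.
have -> : a = i.+1 by lia.
by rewrite binn binSn; lia.
Qed.

Lemma card_fibers_leq (T : finType) (A : {set T}) (h : T -> nat) (a m : nat) :
  (forall x, x \in A -> h x < a) ->
  (forall i, i < a -> #|[set x in A | h x == i]| <= m) -> #|A| <= a * m.
Proof.
move=> lt_h le_m; rewrite -[a]card_ord -sum_nat_const -sum1_card.
rewrite (eq_bigr (fun x => \sum_(i < a) (h x == i))) => [|x xA]; last first.
  rewrite (bigD1 (Ordinal (lt_h x xA))) //= eqxx big1 // => i.
  by rewrite -val_eqE /= eq_sym => /negbTE ->.
rewrite exchange_big; apply: leq_sum => i _; apply: leq_trans (le_m i (ltn_ord i)).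
by rewrite -sum1dep_card big_mkcondr; apply: leq_sum => x _; case: (h x == i).
Qed.

(** * Maximal chains as permutations, and how many pass through given sets *)

Section Chains.

Variable n : nat.
Implicit Types (s t : 'S_n) (X Y Z : {set 'I_n}) (G F : {set {set 'I_n}}).

(* The sets [initial s 0, ..., initial s n] form the maximal chain of [s]. *)
Definition initial s (j : nat) : {set 'I_n} := [set x | s x < j].

Definition on_chain s X : bool := X == initial s #|X|.

Lemma card_initial s j : j <= n -> #|initial s j| = j.
Proof.
move=> le_jn.
have -> : initial s j = s @^-1: [set x : 'I_n | x < j].
  by apply/setP => x; rewrite !inE.
rewrite card_preimset; last exact: perm_inj.
have -> : [set x : 'I_n | x < j] = [set widen_ord le_jn y | y : 'I_j].
  apply/setP => x; rewrite inE; apply/idP/imsetP => [ltx | [y _ ->]] /=.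
    by exists (Ordinal ltx) => //; apply: val_inj.
  exact: ltn_ord.
rewrite card_imset ?card_ord // => y z /(congr1 val) /= eyz.
exact: val_inj.
Qed.

Lemma initialS s i j : i <= j -> initial s i \subset initial s j.
Proof. by move=> ij; apply/subsetP => x; rewrite !inE => /leq_trans; apply. Qed.

Lemma on_chain_total s X Y :
  on_chain s X -> on_chain s Y -> (X \subset Y) || (Y \subset X).
Proof.
move=> /eqP eX /eqP eY; rewrite eX eY.
by case/orP: (leq_total #|X| #|Y|) => /(initialS s) ->; rewrite ?orbT.
Qed.

Lemma on_chain_initial s j : j <= n -> on_chain s (initial s j).
Proof. by move=> le_jn; rewrite /on_chain card_initial. Qed.

Lemma on_chain0 s : on_chain s set0.
Proof. by rewrite /on_chain cards0 eq_sym; apply/eqP/setP => x; rewrite !inE. Qed.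

Lemma on_chainT s : on_chain s setT.
Proof.
by rewrite /on_chain cardsT card_ord eq_sym; apply/eqP/setP => x; rewrite !inE ltn_ord.
Qed.

(** Arguments may repeat: [chains3 X Z Z] counts the chains through two sets, [chains3 Y Y Y] those
    through one. *)
Definition chains3 X Y Z : nat :=
  \sum_(s : 'S_n) on_chain s X * on_chain s Y * on_chain s Z.

Lemma on_chain_perm t s X : on_chain (t * s) (t @^-1: X) = on_chain s X.
Proof.
rewrite /on_chain card_preimset; last exact: perm_inj.
apply/eqP/eqP => e; apply/setP => x; last by rewrite {1}e !inE permM.
by move/setP in e; have := e (t^-1%g x); rewrite !inE permM permKV.
Qed.

Lemma chains3_perm t X Y Z :
  chains3 (t @^-1: X) (t @^-1: Y) (t @^-1: Z) = chains3 X Y Z.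
Proof.
rewrite /chains3 (reindex_inj (mulgI t)) /=.
by apply: eq_bigr => s _; rewrite !on_chain_perm.
Qed.

Lemma preim_tperm_id x y X :
  (x \in X) = (y \in X) -> tperm x y @^-1: X = X.
Proof.
by move=> exy; apply/setP => z; rewrite !inE; case: tpermP => [->|->|].
Qed.

(** Swapping a point of [Y] outside [Y'] with a point of [Y'] outside [Y] fixes [X] and [Z], since
    both points lie in [Z] but not in [X], and it brings [Y] closer to [Y']. *)
Lemma chains3_mid X Y Y' Z :
  X \subset Y -> Y \subset Z -> X \subset Y' -> Y' \subset Z ->
  #|Y| = #|Y'| -> chains3 X Y Z = chains3 X Y' Z.
Proof.
have [d] := ubnP #|Y :\: Y'|; elim: d Y => // d IHd Y ltd XY YZ XY' Y'Z eYY'.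
have [sub|/subsetPn[x xY xY']] := boolP (Y \subset Y').
  by have/eqP -> : Y == Y' by rewrite eqEcard sub eYY' /=.
have /subsetPn[y yY' yY] : ~~ (Y' \subset Y).
  apply: contra xY' => sub.
  by have/eqP -> : Y' == Y by rewrite eqEcard sub eYY' /=.
have xX : x \notin X by apply: contra xY' => /(subsetP XY').
have yX : y \notin X by apply: contra yY => /(subsetP XY).
have xZ : x \in Z by apply: (subsetP YZ).
have yZ : y \in Z by apply: (subsetP Y'Z).
rewrite -(chains3_perm (tperm x y)).
rewrite (@preim_tperm_id x y X) ?(negbTE xX) ?(negbTE yX) //.
rewrite (@preim_tperm_id x y Z) ?xZ ?yZ //.
apply: IHd => //; last by rewrite card_preimset //; apply: perm_inj.
- rewrite -ltnS; apply: leq_trans ltd; rewrite ltnS; apply: proper_card.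
  apply/properP; split.
    apply/subsetP => z; rewrite !inE.
    by case: tpermP => [->|->|_ _]; rewrite ?(negbTE yY) ?yY' ?andbF.
  by exists x; rewrite !inE ?xY ?xY' // tpermL (negbTE yY).
- apply/subsetP => z zX; rewrite inE tpermD ?(subsetP XY) //.
    by apply: contraNneq xX => ->.
  by apply: contraNneq yX => ->.
- by apply/subsetP => z; rewrite inE; case: tpermP => [->|->|_ _ /(subsetP YZ)].
Qed.

Lemma card_interval X Z (k : nat) : X \subset Z ->
  #|[set Y : {set 'I_n} | [&& X \subset Y, Y \subset Z & #|Y| == #|X| + k]]|
    = 'C(#|Z| - #|X|, k).
Proof.
move=> XZ; rewrite -(cardsDS XZ) -cards_draws.
rewrite -[RHS](@card_in_imset _ _ (fun A => A :|: X)); last first.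
  apply: (can_in_inj (g := fun B => B :\: X)) => A.
  rewrite inE subsetD -andbA => /and3P[_ dAX _].
  by rewrite setDUl setDv setU0; apply/setDidPl.
apply: eq_card => Y; rewrite inE; apply/and3P/imsetP => [[XY YZ /eqP cY]|[A]].
  exists (Y :\: X); last first.
    by rewrite setDE setUIl [~: X :|: X]setUC setUCr setIT; apply/esym/setUidPl.
  by rewrite inE setSD //= cardsDS // cY addKn.
rewrite inE => /andP[sA /eqP cA] ->; split; first exact: subsetUr.
  by rewrite subUset XZ andbT (subset_trans sA) ?subsetDl.
rewrite cardsU; have /eqP -> : A :&: X == set0.
  by rewrite setI_eq0; move: sA; rewrite subsetD => /andP[].
by rewrite cards0 subn0 cA addnC.
Qed.

(** Double counting: each chain through [X] and [Z] passes through exactly one set of size [#|Y|]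
    between them, and by [chains3_mid] all these sets are met equally often. *)
Lemma chains3_bin X Y Z : X \subset Y -> Y \subset Z ->
  chains3 X Y Z * 'C(#|Z| - #|X|, #|Y| - #|X|) = chains3 X Z Z.
Proof.
move=> XY YZ; have XZ := subset_trans XY YZ.
rewrite -(card_interval _ XZ) mulnC -sum_nat_const.
have -> : #|X| + (#|Y| - #|X|) = #|Y| by rewrite subnKC // subset_leq_card.
rewrite (eq_bigr (fun Y' => chains3 X Y' Z)); last first.
  by move=> Y'; rewrite inE => /and3P[XY' Y'Z /eqP cY']; apply: chains3_mid.
rewrite /chains3 exchange_big /=; apply: eq_bigr => s _.
have [sX|_] := boolP (on_chain s X); last by rewrite big1.
have [sZ|_] := boolP (on_chain s Z); last by rewrite !muln0 big1 // => A _; rewrite muln0.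
have leYn : #|Y| <= n by rewrite -[n in _ <= n]card_ord max_card.
rewrite (bigD1 (initial s #|Y|)) /=.
  rewrite on_chain_initial // big1 // => A /andP[].
  rewrite inE => /and3P[_ _ /eqP cA] neA.
  by rewrite /on_chain cA (negbTE neA).
rewrite inE card_initial // eqxx andbT.
by apply/andP; split; [rewrite (eqP sX)|rewrite (eqP sZ)];
   rewrite initialS // subset_leq_card.
Qed.

(** Take [set0] and [setT] as the ends in [chains3_bin]; they lie on every chain. *)
Lemma chains3_fact Y : chains3 Y Y Y * 'C(n, #|Y|) = n`!.
Proof.
have := chains3_bin (sub0set Y) (subsetT Y).
rewrite cards0 cardsT card_ord !subn0 /chains3 => e.
have <- : \sum_(s : 'S_n) 1 = n`! by rewrite sum1_card card_Sn.
transitivity (chains3 set0 setT setT); rewrite /chains3; last first.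
  by apply: eq_bigr => s _; rewrite on_chain0 on_chainT.
rewrite -e; congr (_ * _); apply: eq_bigr => s _.
by rewrite on_chain0 on_chainT; case: (on_chain s Y).
Qed.


(** * Heavy intervals: the moment bound and the tower *)

Definition heavy (m : nat) F X Z : bool :=
  [exists i : 'I_n,
    m <= #|[set Y in F | [&& X \proper Y, Y \proper Z & #|Y| == i]]|].

(* A uniformly random maximal chain through [X] and [Z] contains a given set
   strictly between them with probability at most [1 / (#|Z| - #|X|)], and there
   are fewer than [#|Z| - #|X|] levels, each with at most [m] sets of [G]. *)
Lemma chains3_between m G X Z : X \subset Z -> ~~ heavy m G X Z ->
  \sum_(Y in G | (X \proper Y) && (Y \proper Z)) chains3 X Y Z
    <= m * chains3 X Z Z.
Proof.
move=> XZ lightXZ; set a := #|Z| - #|X|.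
have [a0|a_gt0] := posnP a.
  rewrite big1 // => Y /and3P[_ /proper_card ltXY /proper_card ltYZ].
  by move: a0; rewrite /a; lia.
rewrite -(leq_pmul2r a_gt0) big_distrl /=.
pose B := [set Y in G | (X \proper Y) && (Y \proper Z)].
have cardB : #|B| <= a * m.
  apply: (card_fibers_leq (h := fun Y => #|Y| - #|X|)) => [Y|i lti].
    rewrite inE => /and3P[_ /proper_card ltXY /proper_card ltYZ].
    by rewrite /a; lia.
  (* The level lies below [#|Z|], so it is among the sizes in ['I_n] that [heavy] inspects. *)
  have ltn : i + #|X| < n.
    have : #|Z| <= n by rewrite -[n in _ <= n]card_ord max_card.
    by move: lti; rewrite /a; lia.
  move: lightXZ; rewrite negb_exists => /forallP/(_ (Ordinal ltn)).
  rewrite -ltnNge => /ltnW; apply: leq_trans; apply: subset_leq_card.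
  apply/subsetP => Y; rewrite !inE /= => /andP[/and3P[-> XY ->]] /eqP <-.
  by rewrite XY /= subnK // subset_leq_card // proper_sub.
apply: (@leq_trans (\sum_(Y in B) chains3 X Z Z)); last first.
  by rewrite sum_nat_const mulnAC leq_mul2r (mulnC m) cardB orbT.
rewrite (eq_bigl (fun Y => Y \in B)) => [|Y]; last by rewrite inE.
apply: leq_sum => Y; rewrite inE => /and3P[_ XY YZ].
rewrite -(chains3_bin (proper_sub XY) (proper_sub YZ)) leq_mul2l.
apply/orP; right; apply: leq_bin_interior.
by move: (proper_card XY) (proper_card YZ); lia.
Qed.

(** Three sets on one chain are pairwise comparable, so at least one of their 6 orderings is
    increasing. *)
Lemma chains3_sorted G :
  \sum_(X in G) \sum_(Y in G) \sum_(Z in G) chains3 X Y Z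
    <= 6 * \sum_(X in G) \sum_(Z in G | X \subset Z)
             \sum_(Y in G | (X \subset Y) && (Y \subset Z)) chains3 X Y Z.
Proof.
pose w X Y Z := ((X \subset Y) && (Y \subset Z)) * chains3 X Y Z.
have -> : \sum_(X in G) \sum_(Z in G | X \subset Z)
    \sum_(Y in G | (X \subset Y) && (Y \subset Z)) chains3 X Y Z
  = \sum_(X in G) \sum_(Y in G) \sum_(Z in G) w X Y Z.
  apply: eq_bigr => X _; rewrite [RHS]exchange_big [LHS]big_mkcondr /=.
  apply: eq_bigr => Z _; rewrite big_mkcondr /= /w.
  have [_|/negP nXZ] := boolP (X \subset Z).
    by apply: eq_bigr => Y _; case: (_ && _); rewrite ?mul1n.
  rewrite big1 // => Y _; case: andP => // -[XY YZ].
  by case: nXZ; apply: subset_trans YZ.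
set S := (X in 6 * X).
(* Renaming the summation variables gives the same sum for all six orders of the arguments of
   [w]. *)
have E1 : \sum_(X in G) \sum_(Y in G) \sum_(Z in G) w X Z Y = S.
  by apply: eq_bigr => X _; rewrite exchange_big.
have E2 : \sum_(X in G) \sum_(Y in G) \sum_(Z in G) w Y X Z = S.
  by rewrite exchange_big.
have E3 : \sum_(X in G) \sum_(Y in G) \sum_(Z in G) w Z X Y = S.
  by rewrite -E2; apply: eq_bigr => X _; rewrite exchange_big.
have E4 : \sum_(X in G) \sum_(Y in G) \sum_(Z in G) w Y Z X = S.
  by rewrite exchange_big.
have E5 : \sum_(X in G) \sum_(Y in G) \sum_(Z in G) w Z Y X = S.
  by rewrite -E4; apply: eq_bigr => X _; rewrite exchange_big.
rewrite !mulSn mul0n addn0 -{1}E1 -{1}E2 -{1}E3 -{1}E4 -{1}E5 /S.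
rewrite -!big_split /=; apply: leq_sum => X _.
rewrite -!big_split /=; apply: leq_sum => Y _.
rewrite -!big_split /=; apply: leq_sum => Z _.
rewrite /w /chains3 !big_distrr -!big_split; apply: leq_sum => s _ /=.
have [sX|_] := boolP (on_chain s X); last by rewrite !mul0n.
have [sY|_] := boolP (on_chain s Y); last by rewrite muln0 mul0n.
have [sZ|_] := boolP (on_chain s Z); last by rewrite !muln0.
have := on_chain_total sX sY; have := on_chain_total sX sZ.
have := on_chain_total sY sZ.
by do 6![case: (_ \subset _)].
Qed.

(* With [N s] the number of members of [G] on the chain of [s], the absence of
   heavy intervals gives [\sum N^3 <= K * \sum N^2] for [K = 6 (m + 2)], which
   bounds the average of [N]. *)
Lemma card_no_heavy m G :
  (forall X Z, X \in G -> Z \in G -> X \subset Z -> ~~ heavy m G X Z) ->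
  #|G| <= ((6 * m.+2) ^ 3 + 6 * m.+2) * 'C(n, n./2).
Proof.
move=> light; pose N s := \sum_(X in G) on_chain s X.
set K := 6 * m.+2.
have N2 : \sum_s N s ^ 2 = \sum_(X in G) \sum_(Z in G) chains3 X Z Z.
  rewrite /chains3; under [RHS]eq_bigr do rewrite exchange_big.
  rewrite exchange_big; apply: eq_bigr => s _.
  rewrite -mulnn big_distrlr; apply: eq_bigr => X _; apply: eq_bigr => Z _ /=.
  by case: (on_chain s Z); rewrite ?muln0 ?muln1.
have N3 : \sum_s N s ^ 3 = \sum_(X in G) \sum_(Y in G) \sum_(Z in G) chains3 X Y Z.
  rewrite /chains3; under [RHS]eq_bigr do
    (under eq_bigr do rewrite exchange_big; rewrite exchange_big).
  rewrite exchange_big; apply: eq_bigr => s _.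
  rewrite expnSr -mulnn big_distrlr big_distrl; apply: eq_bigr => X _ /=.
  by rewrite big_distrl; apply: eq_bigr => Y _; rewrite big_distrr.
have le32 : \sum_s N s ^ 3 <= K * \sum_s N s ^ 2.
  rewrite N3 N2; apply: leq_trans (chains3_sorted G) _.
  rewrite -mulnA leq_mul2l /= big_distrr; apply: leq_sum => X XG.
  rewrite big_distrr big_mkcondr; apply: leq_sum => Z ZG /=.
  case XZ: (X \subset Z) => //.
  (* Sets strictly between contribute the [m] of [m.+2]; the cases [Y = X] and [Y = Z] contribute
     the 2. *)
  rewrite (bigID (fun Y => (X \proper Y) && (Y \proper Z))) /=.
  rewrite -addn2 mulnDl; apply: leq_add.
    apply: leq_trans (chains3_between XZ (light X Z XG ZG XZ)).
    rewrite (eq_bigl (fun Y => (Y \in G) && ((X \proper Y) && (Y \proper Z)))) //.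
    move=> Y /=; case XY: (X \proper Y); last by rewrite !andbF.
    case YZ: (Y \proper Z); last by rewrite !andbF.
    by rewrite !(proper_sub XY) (proper_sub YZ) !andbT.
  apply: (@leq_trans (\sum_(Y in [set X; Z]) chains3 X Z Z)); last first.
    by rewrite sum_nat_const leq_mul2r cards2; case: (X != Z); rewrite orbT.
  rewrite big_mkcond [X in _ <= X]big_mkcond; apply: leq_sum => Y _.
  case: ifP => // /andP[/and3P[_ XY YZ]].
  rewrite !properEneq XY YZ !andbT negb_and !negbK !inE => /orP eY.
  have -> : (Y == X) || (Y == Z) by case: eY => /eqP ->; rewrite eqxx ?orbT.
  rewrite /chains3; apply: leq_sum => s _.
  by do 3!case: (on_chain s _).
(* If [N s <= K], compare termwise with [K ^ 3 + K]; otherwise [N s ^ 3] is at least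
   [K.+1 * N s ^ 2]. Summed over [s], the square terms cancel against [le32]. *)
have pointwise s : K * N s ^ 2 + N s <= N s ^ 3 + (K ^ 3 + K).
  have [le|lt] := leqP (N s) K.
    rewrite (leq_trans _ (leq_addl _ _)) // leq_add //.
    by rewrite (expnS K) leq_mul2l leq_exp2r // le orbT.
  rewrite (leq_trans _ (leq_addr _ _)) // (expnS _ 2).
  apply: (@leq_trans (K.+1 * N s ^ 2)); last by rewrite leq_mul2r lt orbT.
  by rewrite mulSn addnC leq_add2r -mulnn leq_pmull //; apply: leq_ltn_trans lt.
have sumN : \sum_s N s <= n`! * (K ^ 3 + K).
  have : \sum_s (K * N s ^ 2 + N s) <= \sum_s (N s ^ 3 + (K ^ 3 + K)).
    by apply: leq_sum => s _.
  rewrite [X in _ <= X]big_split big_split -big_distrr sum_nat_const card_Sn /= => le.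
  by rewrite -(leq_add2l (K * \sum_s N s ^ 2)) (leq_trans le) // leq_add2r.
(* By [chains3_fact] each member lies on at least [n!] divided by the middle binomial coefficient
   many chains. *)
rewrite -(leq_pmul2l (fact_gt0 n)) mulnA.
apply: (@leq_trans ((\sum_s N s) * 'C(n, n./2))); last by rewrite leq_mul2r sumN orbT.
rewrite /N exchange_big mulnC -sum_nat_const big_distrl; apply: leq_sum => X _ /=.
rewrite -(chains3_fact X); apply: leq_mul (leq_bin_half _ _).
by apply: leq_sum => s _; case: (on_chain s X).
Qed.

(** The top [Z] is kept in the family: a tower found among the bottoms [F'] ends at some [X] in
    [F'], above which one more heavy interval of [F] fits. *)
Lemma heavy_tower m (B j : nat) F :
  (forall G, (forall X Z, X \in G -> Z \in G -> X \subset Z -> ~~ heavy m G X Z) ->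
    #|G| <= B) ->
  j * B < #|F| ->
  exists Z (A : nat -> {set {set 'I_n}}), Z \in F /\
    [/\ forall i, i < j -> m <= #|A i| /\ A i \subset F,
       forall i Y, i < j -> Y \in A i -> Y \proper Z,
       forall i Y Y', i < j -> Y \in A i -> Y' \in A i -> #|Y| = #|Y'|
     & forall i i' Y Y', i < i' < j -> Y \in A i -> Y' \in A i' -> Y \proper Y'].
Proof.
move=> bound; elim: j F => [|j IHj] F ltF.
  have /card_gt0P[Z ZF] := ltF.
  exists Z, (fun=> set0); split=> //; split=> // i i' Y Y'.
  by rewrite ltn0 andbF.
pose F' := [set X in F | [exists Z in F, (X \subset Z) && heavy m F X Z]].
have F'F : F' \subset F by apply/subsetP => X; rewrite inE => /andP[].
have leD : #|F :\: F'| <= B.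
  (* An interval heavy in [F :\: F'] is heavy in [F], which would put its bottom into [F']. *)
  apply: bound => X Z; rewrite !inE negb_and => /andP[+ XF] /andP[_ ZF] XZ.
  rewrite XF /= negb_exists => /forallP/(_ Z); rewrite ZF XZ /=.
  apply: contra => /existsP[i le]; apply/existsP; exists i.
  apply: leq_trans le _; apply: subset_leq_card.
  by apply/subsetP => Y; rewrite !inE => /andP[/andP[_ ->]].
have /IHj[X [A [XF' [card_A A_X size_A nest_A]]]] : j * B < #|F'|.
  by have := cardsDS F'F; have := subset_leq_card F'F; move: ltF; rewrite mulSn; lia.
move: XF'; rewrite inE => /andP[XF /existsP[Z /and3P[ZF XZ /existsP[l le_l]]]].
set L := [set Y in F | _] in le_l.
exists Z, (fun i => if i < j then A i else L); split=> //.
split.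
- move=> i _; case: ifP => [/card_A[? AF']|_].
    by split=> //; apply: subset_trans F'F.
  by split=> //; apply/subsetP => Y; rewrite inE => /andP[].
- move=> i Y _; case: ifP => [ij YA|_].
    exact: proper_sub_trans (A_X _ _ ij YA) XZ.
  by rewrite inE => /and4P[].
- move=> i Y Y' _; case: ifP => [ij|_]; first exact: size_A.
  by rewrite !inE => /and4P[_ _ _ /eqP ->] /and4P[_ _ _ /eqP ->].
- move=> i i' Y Y' /andP[ii' i'j].
  have ij : i < j by apply: leq_trans ii' _.
  rewrite ij; case: ifP => [i'j'|_] YA; first by apply: nest_A YA; rewrite ii'.
  rewrite inE => /and4P[_ XY' _ _]; exact: proper_trans (A_X _ _ ij YA) XY'.
Qed.

End Chains.

(** * Embedding the poset into a tower *)

Theorem theorem3p2 (d : Order.disp_t) (P : finPOrderType d) (k : nat)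
    (c : P -> 'I_k) (hc : order_preserving_coloring c) :
  exists C : nat, forall (n : nat) (F : {set {set 'I_n}}),
    (C * 'C(n, n./2) < #|F|)%N ->
    exists f : P -> {set 'I_n},
      [/\ embedding f,
          forall a : P, f a \in F
        & forall a b : P, c a = c b -> #|f a| = #|f b|].
Proof.
pose m := #|P|; pose B := ((6 * m.+2) ^ 3 + 6 * m.+2).
(* One interval per color, each costing at most [B] sets. *)
exists (k * B) => n F; rewrite -mulnA.
case/(heavy_tower (@card_no_heavy n m)) => Z [A [_ [card_A _ size_A nest_A]]].
(* The rank of [a] in all of [P] serves as index: ranks are distinct within a color class, and being
   below [m] they never reach the default [set0]. *)
pose f a := nth set0 (enum (A (c a))) (enum_rank a).
have ltA a : enum_rank a < size (enum (A (c a))).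
  rewrite -cardE; apply: leq_trans (proj1 (card_A _ (ltn_ord (c a)))).
  exact: ltn_ord.
have fA a : f a \in A (c a) by rewrite -mem_enum mem_nth.
have f_lt a b : c a < c b -> f a \proper f b.
  by move=> ab; apply: nest_A (fA a) (fA b); rewrite ab ltn_ord.
exists f; split=> [|a|a b cab].
- split=> [a b fab|a b /(proj2 hc)/f_lt/proper_sub //].
  have [ab|ab|/val_inj cab] := ltngtP (c a) (c b).
  + by have := f_lt _ _ ab; rewrite fab properxx.
  + by have := f_lt _ _ ab; rewrite fab properxx.
  apply: enum_rank_inj; apply: val_inj => /=; apply/eqP.
  move: fab (ltA a) (ltA b); rewrite /f cab => fab lta ltb.
  by rewrite -(nth_uniq set0 lta ltb (enum_uniq _)) fab.
- by apply: (subsetP (proj2 (card_A _ (ltn_ord (c a))))).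
- by apply: (size_A (c a)) => //; rewrite cab.
Qed.
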